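(* Let $\mathcal{X}$ be a complex Banach space. If $A\in\mathcal{B}(\mathcal{X})$ is an isometry and $B\in\mathcal{B}(\mathcal{X})$ is a contraction, then $\mathscr{N}(\delta_{A,B})\perp\mathscr{R}(\delta_{A,B})$.
   Context: $\mathcal{B}(\mathcal{X})$ is the Banach algebra of all bounded linear operators on $\mathcal{X}$. The generalized derivation $\delta_{A,B}\colon\mathcal{B}(\mathcal{X})\to\mathcal{B}(\mathcal{X})$ is $\delta_{A,B}(X)=AX-XB$, and $\mathscr{N}(\delta_{A,B})$, $\mathscr{R}(\delta_{A,B})$ are its null space and range. An isometry is an operator $A$ with $\|Ax\|=\|x\|$ for all $x$ (not necessarily surjective); a contraction is an operator $B$ with $\|B\|\leq 1$. For linear submanifolds $\mathscr{K},\mathscr{M}$ of a Banach space, $\mathscr{K}\perp\mathscr{M}$ ($\mathscr{K}$ is Birkhoff-James orthogonal to $\mathscr{M}$) means $\|x-y\|\geq\|x\|$ for all $x\in\mathscr{K}$ and all $y\in\mathscr{M}$. *)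

(* Defs.v *)
From HB Require Import structures.
From mathcomp Require Import all_boot all_order all_algebra.
From mathcomp Require Import complex.
From mathcomp Require Import boolp classical_sets functions reals topology.
From mathcomp Require Import normedtype.

Set Implicit Arguments.
Unset Strict Implicit.
Unset Printing Implicit Defensive.

Import Order.TTheory GRing.Theory Num.Theory.
Import numFieldNormedType.Exports.

Local Open Scope classical_set_scope.
Local Open Scope ring_scope.
Local Open Scope complex_scope.

Section BoundedOperators.
Variables (R : realType) (X : normedModType R[i]).

Definition bounded_linear : pred (X -> X) := fun f =>
  `[< linear f /\ exists M : R[i], forall x, `|f x| <= M * `|x| >].

Record boundedOp := BoundedOp {
  boundedOp_fun :> X -> X;
  boundedOp_subproof : boundedOp_fun \in bounded_linear }.

HB.instance Definition _ := [isSub for boundedOp_fun].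
HB.instance Definition _ := [Choice of boundedOp by <:].

Lemma bounded_linear_submod_closed : submod_closed bounded_linear.
Proof.
split.
  apply/asboolP; split; first by move=> a x y; rewrite /= scaler0 addr0.
  by exists 0 => x; rewrite normr0 mul0r.
move=> a f g /asboolP[fL [M fM]] /asboolP[gL [N gN]]; apply/asboolP; split.
  move=> b x y.
  rewrite -[LHS]/(a *: f (b *: x + y) + g (b *: x + y)).
  rewrite -[RHS]/(b *: (a *: f x + g x) + (a *: f y + g y)).
  rewrite fL gL !scalerDr !scalerA [a * b]mulrC !addrA; congr (_ + _).
  by rewrite -!addrA; congr (_ + _); rewrite addrC.
exists (`|a| * M + N) => x; rewrite -[X in `|X|]/(a *: f x + g x).
rewrite (le_trans (ler_normD _ _))// mulrDl lerD// normrZ -mulrA.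
by rewrite ler_wpM2l.
Qed.

HB.instance Definition _ :=
  GRing.isSubmodClosed.Build R[i] (X -> X) bounded_linear
    bounded_linear_submod_closed.

HB.instance Definition _ := [SubChoice_isSubLmodule of boundedOp by <:].

Lemma boundedOpP (f g : boundedOp) : (forall x, f x = g x) -> f = g.
Proof. by move=> fg; apply/val_inj/funext. Qed.

Lemma boundedOp_linear (f : boundedOp) : linear f.
Proof. by case: f => f /= /asboolP[]. Qed.

HB.instance Definition _ (f : boundedOp) :=
  GRing.isLinear.Build R[i] X X _ f (@boundedOp_linear f).

Lemma boundedOp_bounded (f : boundedOp) :
  exists M : R[i], forall x, `|f x| <= M * `|x|.
Proof. by case: f => f /= /asboolP[]. Qed.

Lemma boundedOpD (f g : boundedOp) x : (f + g) x = f x + g x.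
Proof. by []. Qed.

Lemma boundedOpN (f : boundedOp) x : (- f) x = - f x.
Proof. by []. Qed.

Lemma boundedOpZ (a : R[i]) (f : boundedOp) x : (a *: f) x = a *: f x.
Proof. by []. Qed.

Lemma boundedOp0 x : (0 : boundedOp) x = 0.
Proof. by []. Qed.

Lemma bounded_linear_id : (@idfun X : X -> X) \in bounded_linear.
Proof. by apply/asboolP; split => //; exists 1 => x; rewrite mul1r. Qed.

Lemma bounded_linear_comp (f g : boundedOp) :
  ((f : X -> X) \o g) \in bounded_linear.
Proof.
apply/asboolP; split; first by move=> a x y /=; rewrite !linearP.
have [M fM] := boundedOp_bounded f; have [N gN] := boundedOp_bounded g.
have [[x x0]|X0] := pselect (exists x : X, x != 0); last first.
  exists 0 => x /=; suff -> : x = 0 by rewrite !linear0 normr0 mul0r.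
  by apply: contrapT => /eqP x0; apply: X0; exists x.
have M0 : 0 <= M.
  by rewrite -(pmulr_lge0 _ (_ : 0 < `|x|)) ?normr_gt0// (le_trans _ (fM x)).
exists (M * N) => y /=.
by rewrite (le_trans (fM _))// -mulrA ler_wpM2l.
Qed.

Definition boundedOp_id := BoundedOp bounded_linear_id.
Definition boundedOp_comp (f g : boundedOp) :=
  BoundedOp (bounded_linear_comp f g).

Lemma boundedOp_compA : associative boundedOp_comp.
Proof. by move=> f g h; apply: boundedOpP. Qed.
Lemma boundedOp_comp1l : left_id boundedOp_id boundedOp_comp.
Proof. by move=> f; apply: boundedOpP. Qed.
Lemma boundedOp_comp1r : right_id boundedOp_id boundedOp_comp.
Proof. by move=> f; apply: boundedOpP. Qed.
Lemma boundedOp_compDl : left_distributive boundedOp_comp +%R.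
Proof. by move=> f g h; apply: boundedOpP. Qed.
Lemma boundedOp_compDr : right_distributive boundedOp_comp +%R.
Proof. by move=> f g h; apply: boundedOpP => x /=; rewrite linearD. Qed.

HB.instance Definition _ := GRing.Zmodule_isPzRing.Build boundedOp
  boundedOp_compA boundedOp_comp1l boundedOp_comp1r
  boundedOp_compDl boundedOp_compDr.

Lemma boundedOpM (f g : boundedOp) x : (f * g) x = f (g x).
Proof. by []. Qed.

(* The norm of a normed module over R[i] is R[i]-valued, whereas sup is
   taken in R, hence the coercions Re and %:C. *)
Definition op_norm (f : boundedOp) : R[i] :=
  (sup [set complex.Re `|f x| | x in [set x | `|x| <= 1]])%:C.

Lemma op_norm_le (f : boundedOp) (M : R[i]) :
  (forall x, `|x| <= 1 -> `|f x| <= M) -> op_norm f <= M.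
Proof.
move=> fM; have M0 : 0 <= M by rewrite (le_trans _ (fM 0 _)) ?normr0.
rewrite lecE /=; have := M0; rewrite lecE /= => /andP[-> _] /=.
apply: ge_sup; first by exists (complex.Re `|f 0|); exists 0; rewrite //= normr0.
by move=> _ [x /= x1 <-]; have := fM x x1; rewrite lecE => /andP[].
Qed.

Lemma le_op_norm1 (f : boundedOp) x : `|x| <= 1 -> `|f x| <= op_norm f.
Proof.
move=> x1; have [M fM] := boundedOp_bounded f.
have := normr_ge0 (f x); rewrite !lecE /= => /andP[/eqP im0 _].
rewrite im0 eqxx /=; apply: ub_le_sup; last by exists x.
exists (complex.Re `|M|) => _ [y /= y1 <-].
have : `|f y| <= `|M|.
  rewrite -normr_id (le_trans (_ : _ <= `|M * `|y| |))//.
    by rewrite ger0_le_norm ?nnegrE// (le_trans _ (fM y)).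
  by rewrite normrM normr_id ler_piMr.
by rewrite lecE => /andP[].
Qed.

Lemma op_norm_ge0 (f : boundedOp) : 0 <= op_norm f.
Proof. by rewrite (le_trans _ (@le_op_norm1 f 0 _)) ?normr0. Qed.

Lemma le_op_norm (f : boundedOp) x : `|f x| <= op_norm f * `|x|.
Proof.
have [->|x0] := eqVneq x 0; first by rewrite linear0 !normr0 mulr0.
have nx0 : 0 < `|x| by rewrite normr_gt0.
rewrite -ler_pdivrMr// mulrC.
have -> : `|x|^-1 * `|f x| = `|f (`|x|^-1 *: x)|.
  by rewrite linearZ normrZ ger0_norm// invr_ge0.
by apply: le_op_norm1; rewrite normrZ ger0_norm ?invr_ge0// mulVf ?gt_eqF.
Qed.

Lemma op_normD (f g : boundedOp) : op_norm (f + g) <= op_norm f + op_norm g.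
Proof.
apply: op_norm_le => x x1; rewrite boundedOpD (le_trans (ler_normD _ _))//.
by rewrite lerD// le_op_norm1.
Qed.

Lemma op_normZ (a : R[i]) (f : boundedOp) : op_norm (a *: f) = `|a| * op_norm f.
Proof.
have le b g : op_norm (b *: g) <= `|b| * op_norm g.
  apply: op_norm_le => x x1; rewrite boundedOpZ normrZ.
  by rewrite ler_wpM2l// le_op_norm1.
apply/eqP; rewrite eq_le le /=.
have [->|a0] := eqVneq a 0; first by rewrite normr0 mul0r op_norm_ge0.
rewrite mulrC -ler_pdivlMr ?normr_gt0// mulrC -normfV.
by rewrite -{1}[f]scale1r -(mulVf a0) -scalerA.
Qed.

Lemma op_norm0_eq0 (f : boundedOp) : op_norm f = 0 -> f = 0.
Proof.
move=> f0; apply: boundedOpP => x; rewrite boundedOp0; apply/eqP.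
by rewrite -normr_le0 (le_trans (le_op_norm f x))// f0 mul0r.
Qed.

HB.instance Definition _ :=
  Lmodule_isNormed.Build R[i] boundedOp op_normD op_normZ op_norm0_eq0.

Lemma boundedOp_normE (f : boundedOp) : `|f| = op_norm f.
Proof. by []. Qed.

Definition op_isometry (A : boundedOp) : Prop := forall x, `|A x| = `|x|.

Definition op_contraction (B : boundedOp) : Prop := `|B| <= 1.

Definition gen_derivation (A B T : boundedOp) : boundedOp := A * T - T * B.

Definition null_space (D : boundedOp -> boundedOp) : set boundedOp :=
  D @^-1` [set 0].

End BoundedOperators.

Definition birkhoff_james_orthogonal (K : numDomainType) (V : normedModType K)
  (E F : set V) := forall x y, E x -> F y -> `|x| <= `|x - y|.

(* Main.v *)
(* If [A T = T B] then [A^i (A S - S B) B^j] telescopes against [A^n S - S B^n],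
   so [n A^n T] differs from [A (A^n S - S B^n)], of norm at most [2 |S|], by [n]
   terms of norm at most [|T - (A S - S B)|].  As [|A^n T| = |T|], this gives
   [n |T| <= n |T - (A S - S B)| + 2 |S|] for every [n]. *)
Require Import Defs.
From mathcomp Require Import all_boot all_order all_algebra.
From mathcomp Require Import complex.
From mathcomp Require Import boolp classical_sets functions reals topology.
From mathcomp Require Import normedtype.

Import Order.TTheory GRing.Theory Num.Theory.

Local Open Scope classical_set_scope.
Local Open Scope ring_scope.
Local Open Scope complex_scope.

(** Dividing by [n] and letting [n] grow removes [c]. The order on [R[i]] compares only numbers with
    equal imaginary parts; nonnegativity makes these parts vanish, which leaves an Archimedean
    argument in [R]. *)
Lemma complex_le_of_natmul_le_add (R : realType) (a b c : R[i]) :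
  0 <= a -> 0 <= b -> 0 <= c ->
  (forall n : nat, a *+ n <= b *+ n + c) -> a <= b.
Proof.
move: a b c => [a ai] [b bi] [c ci].
rewrite !lecE /= => /andP[/eqP-> _] /andP[/eqP-> _] /andP[/eqP-> c0] H.
rewrite eqxx /= leNgt; apply/negP => ba.
have d0 : 0 < a - b by rewrite subr_gt0.
(* This [n] satisfies [c < n (a - b)], against the hypothesis at [n]. *)
pose n := Num.bound (c / (a - b)).
have := H n; rewrite lecE => /andP[_].
rewrite raddfD /= !raddfMn /= leNgt => /negP; apply.
rewrite addrC -ltrBrDr -mulrnBl -mulr_natl -ltr_pdivrMr//.
by apply: archi_boundP; rewrite divr_ge0// ltW.
Qed.

Section OperatorNorm.
Local Set Implicit Arguments.
Local Unset Strict Implicit.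
Context {R : realType} {X : normedModType R[i]}.
Implicit Types A B T S : boundedOp X.

Lemma op_norm_isometryM A T : op_isometry A -> `|A * T| = `|T|.
Proof.
move=> hA; apply/eqP; rewrite eq_le !boundedOp_normE.
apply/andP; split; apply: op_norm_le => x x1.
  by rewrite boundedOpM hA le_op_norm1.
by rewrite -hA -boundedOpM le_op_norm1.
Qed.

Lemma op_norm_isometryXM A T n : op_isometry A -> `|A ^+ n * T| = `|T|.
Proof.
move=> hA; elim: n => [|n IHn]; first by rewrite expr0 mul1r.
by rewrite exprS -mulrA op_norm_isometryM.
Qed.

(** [B] maps the closed unit ball into itself. *)
Lemma op_norm_Mcontraction T B : op_contraction B -> `|T * B| <= `|T|.
Proof.
rewrite /op_contraction !boundedOp_normE => hB; apply: op_norm_le => x x1.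
rewrite boundedOpM le_op_norm1// (le_trans (le_op_norm1 B x1))//.
Qed.

Lemma op_norm_McontractionX T B n : op_contraction B -> `|T * B ^+ n| <= `|T|.
Proof.
move=> hB; elim: n => [|n IHn]; first by rewrite expr0 mulr1.
by rewrite exprSr mulrA (le_trans (op_norm_Mcontraction _ hB)).
Qed.

Lemma intertwiner_expr A B T n : A * T = T * B -> A ^+ n * T = T * B ^+ n.
Proof.
move=> ATB; elim: n => [|n IHn]; first by rewrite !expr0 mul1r mulr1.
by rewrite exprSr exprS -mulrA ATB mulrA IHn -mulrA -exprSr exprS.
Qed.

(** By induction, each step applies the isometry [A], which keeps the norm, and adds one term of
    norm at most [|T - (A S - S B)|]. *)
Lemma intertwiner_telescope_le A B T S n :
  op_isometry A -> op_contraction B -> A * T = T * B ->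
  `|(A ^+ n * T) *+ n - A * gen_derivation (A ^+ n) (B ^+ n) S|
    <= `|T - gen_derivation A B S| *+ n.
Proof.
move=> hA hB ATB; elim: n => [|n IHn].
  by rewrite /gen_derivation !expr0 !mul1r mulr1 subrr mulr0 subr0 normr0.
(* This rests on [A^(n+1) S - S B^(n+1) = A (A^n S - S B^n) + (A S - S B) B^n]; the extra copy of
   [A^n T] becomes [T B^n] to pair with the last term. *)
have -> : (A ^+ n.+1 * T) *+ n.+1 -
    A * gen_derivation (A ^+ n.+1) (B ^+ n.+1) S =
    A * ((A ^+ n * T) *+ n - A * gen_derivation (A ^+ n) (B ^+ n) S) +
    A * ((T - gen_derivation A B S) * B ^+ n).
  rewrite -mulrDr exprS -mulrA -mulrnAr -mulrBr; congr (_ * _).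
  rewrite /gen_derivation mulrBl -(intertwiner_expr n ATB) mulrBl !mulrBr.
  rewrite mulrSr !exprS !mulrA -!addrA; congr (_ + _).
  rewrite !opprB [RHS]addrCA; congr (_ + _).
  by rewrite [RHS]addrC addrA subrK.
rewrite (le_trans (ler_normD _ _))// mulrSr lerD// op_norm_isometryM//.
exact: op_norm_McontractionX.
Qed.

End OperatorNorm.

Theorem corollary4 (R : realType) (X : completeNormedModType R[i])
    (A B : boundedOp X) (hA : op_isometry A) (hB : op_contraction B) :
  birkhoff_james_orthogonal (null_space (gen_derivation A B))
                            (range (gen_derivation A B)).
Proof.
move=> T Y /eqP; rewrite subr_eq0 => /eqP ATB [S _ <-] {Y}.
(* The constant [2 |S|] bounds [|A^n S - S B^n|] for all [n] at once. *)
apply: (@complex_le_of_natmul_le_add _ _ _ (`|S| *+ 2)) => // [|n].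
  by rewrite mulrn_wge0.
(* Now [n |T|] is the norm of [n A^n T], to which the telescoping bound applies. *)
rewrite -(op_norm_isometryXM T n hA) -normrMn.
rewrite -[X in `|X|](subrK (A * gen_derivation (A ^+ n) (B ^+ n) S)).
rewrite (le_trans (ler_normD _ _))// lerD//.
  exact: intertwiner_telescope_le.
rewrite op_norm_isometryM// (le_trans (ler_normB _ _))// mulr2n lerD//.
  by rewrite op_norm_isometryXM.
exact: op_norm_McontractionX.
Qed.
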